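(* Let $G$ be a $J$-colourable graph. Then its shadow graph $s(G)$ is also $J$-colourable, and $\mathscr{J}(s(G))=\mathscr{J}(G)$.
   Context: Graphs are finite, simple and undirected; $G$ is connected. Shadow graph: for a graph $G$ with $V(G)=\{v_1,\ldots,v_n\}$, $s(G)$ is obtained from the Mycielski graph of $G$ by removing the root vertex; that is, $s(G)$ has vertex set $\{v_1,\ldots,v_n,u_1,\ldots,u_n\}$ and its edges are exactly the following: $v_iv_j\in E(s(G))\iff v_iv_j\in E(G)$; and $v_iu_j\in E(s(G))\iff v_iv_j\in E(G)$. Rainbow neighbourhoods: given a proper colouring $\mathcal{C}$ of a graph $H$ (every colour being used), a vertex $v$ belongs to a rainbow neighbourhood of $H$ with respect to $\mathcal{C}$ if its closed neighbourhood $N[v]$ contains at least one vertex of every colour class of $\mathcal{C}$. $J$-colouring: a $J$-colouring of $H$ is a proper colouring of $H$ with the maximal number of colours such that every vertex of $H$ belongs to a rainbow neighbourhood of $H$. $H$ is $J$-colourable if it has such a colouring, and then the $J$-colouring number $\mathscr{J}(H)$ is the number of colours in a $J$-colouring of $H$. *)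

(* Defs.v *)
From mathcomp Require Import all_boot.

Set Implicit Arguments.
Unset Strict Implicit.
Unset Printing Implicit Defensive.

Record sgraph := SGraph {
  vertex :> finType;
  adj : rel vertex;
  adj_sym : symmetric adj;
  adj_irrefl : irreflexive adj
}.

(* The graph with no vertex does not count as connected. *)
Definition connected_graph (G : sgraph) : Prop :=
  0 < #|G| /\ forall x y : G, connect (@adj G) x y.

Definition closed_nbhd (G : sgraph) (v : G) : {set G} :=
  [set w | (w == v) || adj v w].

(* [inl x] is the original vertex and [inr x] its copy, u_i for x = v_i. *)
Definition shadow_adj (G : sgraph) : rel (G + G) := fun a b =>
  match a, b with
  | inl x, inl y => adj x y
  | inl x, inr y => adj x y
  | inr x, inl y => adj x y
  | inr _, inr _ => false
  end.

Lemma shadow_adj_sym (G : sgraph) : symmetric (@shadow_adj G).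
Proof. by case=> x [] y //=; rewrite adj_sym. Qed.

Lemma shadow_adj_irrefl (G : sgraph) : irreflexive (@shadow_adj G).
Proof. by case=> x //=; rewrite adj_irrefl. Qed.

Definition shadow (G : sgraph) : sgraph :=
  SGraph (@shadow_adj_sym G) (@shadow_adj_irrefl G).

(* Every one of the k colours has to be used. *)
Definition proper_coloring (H : sgraph) (k : nat) (c : {ffun H -> 'I_k}) : bool :=
  [forall x, forall y, adj x y ==> (c x != c y)] &&
  [forall i, exists x, c x == i].

Definition in_rainbow_nbhd (H : sgraph) (k : nat) (c : {ffun H -> 'I_k})
    (v : H) : bool :=
  [forall i, exists w in closed_nbhd v, c w == i].

Definition rainbow_coloring (H : sgraph) (k : nat) (c : {ffun H -> 'I_k}) : bool :=
  proper_coloring c && [forall v, in_rainbow_nbhd c v].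

Definition J_coloring (H : sgraph) (k : nat) (c : {ffun H -> 'I_k}) : Prop :=
  rainbow_coloring c /\
  forall (k' : nat) (c' : {ffun H -> 'I_k'}), rainbow_coloring c' -> k' <= k.

Definition J_colorable (H : sgraph) : Prop :=
  exists (k : nat) (c : {ffun H -> 'I_k}), J_coloring c.

(* All colours being used, k ranges over k <= #|H| without loss; the value is
   meaningful only when H is J-colourable (see J_numberE). *)
Definition J_number (H : sgraph) : nat :=
  \max_(k < #|H|.+1 | [exists c : {ffun H -> 'I_k}, rainbow_coloring c]) k.

Lemma rainbow_coloring_leq (H : sgraph) (k : nat) (c : {ffun H -> 'I_k}) :
  rainbow_coloring c -> k <= #|H|.
Proof.
case/andP=> /andP[_ /forallP surj] _.
rewrite -[k in k <= _]card_ord -(@card_codom _ _ (@id 'I_k)) //.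
apply: leq_trans (leq_image_card c predT).
apply: subset_leq_card; apply/subsetP=> i _.
by have /existsP[x /eqP <-] := surj i; apply: image_f.
Qed.

Lemma J_numberE (H : sgraph) (k : nat) (c : {ffun H -> 'I_k}) :
  J_coloring c -> J_number H = k.
Proof.
case=> rc maxk; apply/eqP; rewrite eqn_leq; apply/andP; split.
  by apply/bigmax_leqP=> j /existsP[c' /maxk].
have ltk : k < #|H|.+1 by rewrite ltnS (rainbow_coloring_leq rc).
by apply: (leq_bigmax_cond (Ordinal ltk)); apply/existsP; exists c.
Qed.

(* Main.v *)
Require Import Defs.
From mathcomp Require Import all_boot.

(** Call a proper colouring rainbow when every closed neighbourhood meets every
    colour class.  For each [k], rainbow [k]-colourings exist on [G] if and only
    if they exist on its shadow, so the largest such [k] is the same for both.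

    From [G] to the shadow, give each copy the colour of its original
    ([rainbow_lift]).  From the shadow to [G], restrict to the originals
    ([rainbow_restrict]).  The restriction stays rainbow because of the copies:
    the neighbours of the copy of [x] are exactly the original neighbours of
    [x], so these carry every colour except that of the copy.  The colour of [x]
    itself is absent from its neighbours, hence [x] and its copy have the same
    colour ([shadow_twin_color]), and the neighbours of [x] in [G] together with
    [x] show all the colours. *)

Section ShadowColorings.

Set Implicit Arguments.
Unset Strict Implicit.
Unset Printing Implicit Defensive.

Variables (G : sgraph) (k : nat).

Lemma rainbow_coloringP (H : sgraph) (c : {ffun H -> 'I_k}) :
  reflect [/\ forall x y, adj x y -> c x != c y,
              forall i, exists x, c x = i
            & forall v i, exists2 w, (w == v) || adj v w & c w = i]
          (rainbow_coloring c).
Proof.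
apply: (iffP idP) => [/andP[/andP[/forallP prop /forallP surj] /forallP rain]|].
  split=> [x y|i|v i].
  - by move/forallP: (prop x) => /(_ y) /implyP.
  - by have /existsP[x /eqP] := surj i; exists x.
  - have /forallP/(_ i)/existsP[w /andP[]] := rain v.
    by rewrite inE => vw /eqP; exists w.
case=> prop surj rain; apply/andP; split; first (apply/andP; split).
- by apply/forallP=> x; apply/forallP=> y; apply/implyP; apply: prop.
- by apply/forallP=> i; have [x cx] := surj i; apply/existsP; exists x; apply/eqP.
- apply/forallP=> v; apply/forallP=> i; have [w vw cw] := rain v i.
  by apply/existsP; exists w; rewrite inE vw cw eqxx.
Qed.

Definition shadow_proj (a : shadow G) : G :=
  match a with inl x => x | inr x => x end.

Definition lift_coloring (c : {ffun G -> 'I_k}) : {ffun shadow G -> 'I_k} :=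
  [ffun a => c (shadow_proj a)].

Definition restrict_coloring (c : {ffun shadow G -> 'I_k}) : {ffun G -> 'I_k} :=
  [ffun x => c (inl x)].

(** Projecting the shadow to [G] preserves adjacency, so the lift is proper;
    every colour seen from [x] by a neighbour is seen from its copy by that same
    neighbour, and the colour of [x] is seen by the copy on itself. *)
Lemma rainbow_lift (c : {ffun G -> 'I_k}) :
  rainbow_coloring c -> rainbow_coloring (lift_coloring c).
Proof.
case/rainbow_coloringP=> prop surj rain; apply/rainbow_coloringP; split.
- by case=> x [] y //= xy; rewrite !ffunE; apply: prop.
- by move=> i; have [x cx] := surj i; exists (inl x); rewrite ffunE.
case=> x i; have [w xw cw] := rain x i; first by exists (inl w); rewrite ?ffunE.
case/orP: xw => [/eqP wx|xw].
  by exists (inr x); rewrite ?eqxx // ffunE /= -wx.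
by exists (inl w); rewrite ?ffunE.
Qed.

(** The copy of [x] must see the colour of [x] in its closed neighbourhood, but
    its neighbours are neighbours of [x] and so avoid that colour: only the copy
    itself is left. *)
Lemma shadow_twin_color (c : {ffun shadow G -> 'I_k}) (x : G) :
  rainbow_coloring c -> c (inr x) = c (inl x).
Proof.
case/rainbow_coloringP=> prop _ rain.
have [w /orP[/eqP-> //|]] := rain (inr x) (c (inl x)).
case: w => // y xy cy.
by have := prop (inl x) (inl y) xy; rewrite cy eqxx.
Qed.

Lemma rainbow_restrict (c : {ffun shadow G -> 'I_k}) :
  rainbow_coloring c -> rainbow_coloring (restrict_coloring c).
Proof.
move=> rc; have twin x := shadow_twin_color x rc.
case/rainbow_coloringP: rc => prop surj rain; apply/rainbow_coloringP; split.
- by move=> x y xy; rewrite !ffunE; apply: prop.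
- by move=> i; have [[x|x] cx] := surj i; exists x; rewrite ffunE // -twin.
(* The closed neighbourhood of the copy of [x] is used rather than that of [x]:
   apart from the copy itself, it consists of originals. *)
move=> x i; have [[y|y] xy cy] := rain (inr x) i.
  by exists y; [rewrite [adj x y]xy orbT | rewrite ffunE].
case/orP: xy => // /eqP[yx].
by exists x; rewrite ?eqxx // ffunE -twin -yx.
Qed.

End ShadowColorings.

Theorem theorem3p3 (G : sgraph) (hconn : connected_graph G)
    (hJ : J_colorable G) :
  J_colorable (shadow G) /\ J_number (shadow G) = J_number G.
Proof.
case: hJ => k [c Jc].
have Jlift : J_coloring (lift_coloring c).
  case: Jc => rc maxk; split; first exact: rainbow_lift.
  by move=> k' c' /rainbow_restrict /maxk.
split; first by exists k, (lift_coloring c).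
by rewrite (J_numberE Jlift) (J_numberE Jc).
Qed.
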